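(* Every Fréchet space $X$ with property $(\overline{\Omega})$ has a prominent set.
   Context: Let $X$ be a locally convex space (over $\mathbb{R}$ or $\mathbb{C}$) and $\mathscr{U}_0(X)$ the system of its absolutely convex $0$-neighbourhoods. For $n\in\mathbb{N}_0$, $V\subseteq X$ and an absolutely convex set $U\subseteq X$, the $n$-th Kolmogorov width is $\delta_n(V,U)=\inf\{\delta>0: V\subseteq \delta U+L$ for an at most $n$-dimensional linear subspace $L$ of $X\}$ (with $\inf\emptyset=+\infty$). The diametral dimension of $X$ is $\Delta(X)=\{(\xi_n)_{n\in\mathbb{N}_0}\in\mathbb{R}^{\mathbb{N}_0}: \forall U\in\mathscr{U}_0(X)\ \exists V\in\mathscr{U}_0(X) \text{ with } \xi_n\delta_n(V,U)\to 0\}$. A bounded subset $B$ of $X$ is called prominent if $\Delta(X)=\{\xi\in\mathbb{R}^{\mathbb{N}_0}: \xi_n\delta_n(B,U)\to 0 \text{ for all } U\in\mathscr{U}_0(X)\}$. A Fréchet space $X$ with an increasing fundamental sequence of seminorms $(\|\cdot\|_k)_k$ and corresponding dual norms $\|\varphi\|_k^*=\sup\{|\varphi(x)|:\|x\|_k\le 1\}\in[0,\infty]$ for $\varphi\in X'$ (the topological dual) satisfies $(\overline{\Omega})$ if for every $k\in\mathbb{N}$ there is $\ell\ge k$ such that for every $m\ge\ell$ there is $C>0$ with $(\|\varphi\|_\ell^* )^2\le C\,\|\varphi\|_k^*\,\|\varphi\|_m^*$ for all $\varphi\in X'$. *)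

(* Defs.v *)
From HB Require Import structures.
From mathcomp Require Import all_boot all_order all_algebra.
From mathcomp Require Import all_classical all_reals all_analysis.
From mathcomp Require Import complex.

Set Implicit Arguments.
Unset Strict Implicit.
Unset Printing Implicit Defensive.

Import Order.TTheory GRing.Theory Num.Theory.
Import numFieldNormedType.Exports.

Local Open Scope classical_set_scope.
Local Open Scope ring_scope.

(* The scalar field, with the embedding of R and the R-valued modulus: the norm
   of [R[i]] in MathComp is itself [R[i]]-valued. *)
Variant scalar_kind := RealScalars | ComplexScalars.

Definition scalar_field (R : realType) (c : scalar_kind) : numFieldType :=
  match c with RealScalars => R | ComplexScalars => R[i] end.

Definition of_real (R : realType) (c : scalar_kind) : R -> scalar_field R c :=
  match c with
  | RealScalars => fun r => r
  | ComplexScalars => fun r => real_complex R r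
  end.

Definition modulus (R : realType) (c : scalar_kind) : scalar_field R c -> R :=
  match c with
  | RealScalars => fun a : R => `|a|
  | ComplexScalars => fun a : R[i] => Normc.normc a
  end.

Lemma of_real_modulus (R : realType) (c : scalar_kind) (a : scalar_field R c) :
  of_real c (modulus a) = `|a|.
Proof. by case: c a => //= -[]. Qed.

Section LocallyConvex.
Context {R : realType} {c : scalar_kind}.
Local Notation K := (scalar_field R c).
Context {X : tvsType K}.

Definition absolutely_convex (U : set X) : Prop :=
  convex_set U /\ forall (a : K) (x : X), `|a| <= 1 -> U x -> U (a *: x).

Definition abs_convex_nbhs0 : set (set X) :=
  [set U | nbhs (0 : X) U /\ absolutely_convex U].

Definition dilate (r : R) (U : set X) : set X :=
  [set of_real c r *: x | x in U].

Definition tvs_bounded (B : set X) : Prop :=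
  forall U, abs_convex_nbhs0 U -> exists2 r : R, 0 < r & B `<=` dilate r U.

(* Linear subspaces of dimension at most n, as spans of n vectors. *)
Definition subspace_dim_le (n : nat) (L : set X) : Prop :=
  exists v : 'I_n -> X,
    L = [set x | exists a : 'I_n -> K, x = \sum_(i < n) a i *: v i].

(* [ereal_inf set0 = +oo]. *)
Definition kolmogorov_width (n : nat) (V U : set X) : \bar R :=
  ereal_inf [set d%:E | d in [set d : R | 0 < d /\
    exists2 L : set X, subspace_dim_le n L &
      V `<=` [set u + l | u in dilate d U & l in L]]].

End LocallyConvex.

Section FrechetSpaces.
Context {R : realType} {c : scalar_kind}.
Local Notation K := (scalar_field R c).
Variable X : tvsType K.

Definition diametral_dimension : set (nat -> R) :=
  [set xi | forall U : set X, abs_convex_nbhs0 U ->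
    exists2 V : set X, abs_convex_nbhs0 V &
      ((xi n)%:E * kolmogorov_width n V U)%E @[n --> \oo] --> 0%E].

Definition prominent (B : set X) : Prop :=
  tvs_bounded B /\
  diametral_dimension = [set xi | forall U : set X, abs_convex_nbhs0 U ->
    ((xi n)%:E * kolmogorov_width n B U)%E @[n --> \oo] --> 0%E].

Definition metrizable : Prop :=
  exists d : X -> X -> R,
    [/\ forall x y, d x y = 0 <-> x = y,
        forall x y, d x y = d y x,
        forall x y z, d x z <= d x y + d y z &
        forall (x : X) (A : set X),
          nbhs x A <-> exists2 e : R, 0 < e & [set y | d x y < e] `<=` A].

(* The uniform structure carried by a [tvsType] is only required to induce the
   topology, not to be translation invariant, so the library's [cauchy] may
   differ from the Cauchy condition of the topological vector space. *)
Definition tvs_complete : Prop :=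
  forall F : set_system X, ProperFilter F ->
    (forall U : set X, nbhs (0 : X) U ->
       exists2 A : set X, F A & forall x y, A x -> A y -> U (x - y)) ->
    exists x : X, F --> x.

Definition frechet : Prop := metrizable /\ tvs_complete.

Definition seminorm (p : X -> R) : Prop :=
  (forall x y, p (x + y) <= p x + p y) /\
  (forall (a : K) x, p (a *: x) = modulus a * p x).

Definition fundamental_seminorms (p : nat -> X -> R) : Prop :=
  [/\ forall k, seminorm (p k),
      forall k x, p k x <= p k.+1 x &
      forall U : set X, nbhs (0 : X) U <->
        exists k, exists2 e : R, 0 < e & [set x | p k x < e] `<=` U].

Definition dual_norm (p : X -> R) (phi : X -> K) : \bar R :=
  ereal_sup [set (modulus (phi x))%:E | x in [set x | p x <= 1]].

Definition Omega_bar (p : nat -> X -> R) : Prop :=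
  forall k, exists2 l, (k <= l)%N & forall m, (l <= m)%N ->
    exists2 C : R, 0 < C &
      forall phi : {linear X -> K^o}, continuous (phi : X -> K^o) ->
        (dual_norm (p l) phi ^+ 2 <=
         C%:E * dual_norm (p k) phi * dual_norm (p m) phi)%E.

End FrechetSpaces.

(* Main.v *)
(** By Hahn-Banach, [Omega_bar] says that for every [k] there is [l] such that,
    for all [m] and [r > 0],
      [U_l c= C_m (r U_m + r^-1 U_k)],
    where [U_k] is the unit ball of the [k]-th seminorm. Applying this twice gives
    [U_l c= C_m (r U_m + r^-3 U_k)], and the gain swallows the constant:
    [U_l c= t U_m + t^-1 U_k] for [t >= T_m]. As no constant depends on [m] any
    more, [m] may tend to infinity with [t], and a Mittag-Leffler correction of
    the [U_m]-part produces a bounded set [B], an intersection of multiples of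
    the [U_j], with [U_l c= t B + 2 t^-1 U_k] for [t] large.

    If now [B c= d U_l + L], then taking [t] about [(2 d)^-1] yields
    [U_l c= 2^-1 U_l + L + 8 d U_k], and iterating, [U_l c= 17 d U_k + L]. Hence
    the widths of [U_l] with respect to [U_k] are at most a constant times those
    of [B] with respect to [U_l]. *)

Require Import Defs.
From HB Require Import structures.
From mathcomp Require Import all_boot all_order all_algebra.
From mathcomp Require Import all_classical all_reals all_analysis.
From mathcomp Require Import complex ring lra.

Set Implicit Arguments.
Unset Strict Implicit.
Unset Printing Implicit Defensive.

Import Order.TTheory GRing.Theory Num.Theory.
Import numFieldNormedType.Exports.

Local Open Scope classical_set_scope.
Local Open Scope ring_scope.

(** * The Hahn-Banach theorem for real sublinear functionals *)

Section HahnBanachReal.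
Context {R : realType} {V : lmodType R} (q : V -> R).
Hypothesis q_subadd : forall x y, q (x + y) <= q x + q y.
Hypothesis q_homo : forall (r : R) x, 0 < r -> q (r *: x) = r * q x.

(** Partial linear functionals are encoded by their graphs, so that extension is inclusion. The
    empty set qualifies as well. *)
Definition linear_graph (G : set (V * R)) : Prop :=
  forall x a y b (r : R), G (x, a) -> G (y, b) -> G (x + r *: y, a + r * b).

Definition dominated (G : set (V * R)) : Prop := forall x a, G (x, a) -> a <= q x.

Definition adjoin (G : set (V * R)) (z : V) (c : R) : set (V * R) :=
  [set (u.1 + r *: z, u.2 + r * c) | u in G & r in [set: R]].

Lemma linear_graph0 G x a : linear_graph G -> G (x, a) -> G (0, 0).
Proof.
move=> linG Gxa; have := linG _ _ _ _ (-1) Gxa Gxa.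
by rewrite scaleN1r subrr mulN1r subrr.
Qed.

Lemma linear_graphZ G x a (r : R) : linear_graph G -> G (x, a) -> G (r *: x, r * a).
Proof.
move=> linG Gxa; have := linG _ _ _ _ r (linear_graph0 linG Gxa) Gxa.
by rewrite !add0r.
Qed.

Lemma linear_graph_adjoin G z c : linear_graph G -> linear_graph (adjoin G z c).
Proof.
move=> linG x a y b r [[x1 a1] G1] [s1 _] [<- <-] [[x2 a2] G2] [s2 _] [<- <-] /=.
exists (x1 + r *: x2, a1 + r * a2); first exact: linG.
exists (s1 + r * s2) => //=; congr pair; last by ring.
by rewrite scalerDr scalerA scalerDl addrACA.
Qed.

(** The value at [z] must lie between all [b' - q (y' - z)] and all [q (y + z) - b]. Subadditivity
    puts the former below the latter, so the supremum of the former works, and homogeneity handles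
    the other multiples of [z]. *)
Lemma dominated_adjoin G z : G !=set0 -> linear_graph G -> dominated G ->
  exists c, dominated (adjoin G z c).
Proof.
move=> [[x0 a0] G0] linG domG.
pose S := [set u.2 - q (u.1 - z) | u in G].
have S0 : S !=set0 by exists (a0 - q (x0 - z)); exists (x0, a0).
have Sub y b : G (y, b) -> ubound S (q (y + z) - b).
  move=> Gyb _ [[y' b'] Gyb' <-] /=.
  have := linG _ _ _ _ 1 Gyb Gyb'; rewrite scale1r mul1r => /domG.
  have := q_subadd (y + z) (y' - z); rewrite addrACA subrr addr0; lra.
have hS : has_sup S by split => //; exists (q (x0 + z) - a0); exact: Sub.
exists (sup S) => _ _ [[y b] Gyb] [r _] [<- <-] /=.
have [r0|r0|->] := ltgtP r 0; last by rewrite scale0r mul0r !addr0; exact: domG.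
- have Gy := linear_graphZ (- r)^-1 linG Gyb.
  have : (- r)^-1 * b - q ((- r)^-1 *: y - z) <= sup S.
    by apply: ub_le_sup; [case: hS|exists ((- r)^-1 *: y, (- r)^-1 * b)].
  have nr0 : 0 < - r by lra.
  have -> : (- r)^-1 *: y - z = (- r)^-1 *: (y + r *: z).
    by rewrite scalerDr scalerA invrN mulNr mulVf ?ltr0_neq0// scaleN1r.
  rewrite q_homo ?invr_gt0// -mulrBr ler_pdivrMl//; lra.
- have Gy := linear_graphZ r^-1 linG Gyb.
  have : sup S <= q (r^-1 *: y + z) - r^-1 * b by apply: ge_sup => //; exact: Sub.
  have -> : r^-1 *: y + z = r^-1 *: (y + r *: z).
    by rewrite scalerDr scalerA mulVf ?gt_eqF// scale1r.
  rewrite q_homo ?invr_gt0// -mulrBr ler_pdivlMl//; lra.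
Qed.

Lemma hahn_banach_real (x0 : V) : exists f : V -> R,
  [/\ forall x y (r : R), f (x + r *: y) = f x + r * f y,
      forall x, f x <= q x & f x0 = q x0].
Proof.
have q0 : q 0 = 0.
  by have := q_homo 0 (ltr0n R 2); rewrite scaler0; lra.
have qN x : - q (- x) <= q x by have := q_subadd x (- x); rewrite subrr q0; lra.
(* The third clause is conditional because the union of the empty chain in Zorn's lemma is empty;
   [base] then shows that a maximal graph is nonempty. *)
pose P G := [/\ linear_graph G, dominated G & G !=set0 -> G (x0, q x0)].
have base : P [set (r *: x0, r * q x0) | r in [set: R]].
  split.
  - move=> _ _ _ _ r [s _ [<- <-]] [t _ [<- <-]]; exists (s + r * t) => //.
    by rewrite scalerDl scalerA mulrDl mulrA.
  - move=> _ _ [r _ [<- <-]]; have [r0|r0|->] := ltgtP r 0.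
    + apply: le_trans (qN _); rewrite -scaleNr q_homo ?oppr_gt0//; lra.
    + by rewrite q_homo.
    + by rewrite scale0r q0 mul0r.
  - by move=> _; exists 1 => //; rewrite scale1r mul1r.
have [G [[linG domG G1] maxG]] : exists G, P G /\ forall B, G `<` B -> ~ P B.
  apply: Zorn_bigcup => F FP Ftot; split.
  - move=> x a y b r [A FA Axa] [B FB Byb].
    have [AB|BA] := Ftot _ _ FA FB.
      by exists B => //; case: (FP _ FB) => + _ _; apply => //; exact: AB.
    by exists A => //; case: (FP _ FA) => + _ _; apply => //; exact: BA.
  - by move=> x a [A FA Axa]; case: (FP _ FA) => _ + _; exact.
  - move=> [u [A FA Au]]; exists A => //.
    by case: (FP _ FA) => _ _; apply; exists u.
have Gn0 : G !=set0.
  apply: contrapT => /set0P/negP; rewrite negbK => /eqP GE.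
  apply: (maxG _ _ base); rewrite GE; split; first by move=> ? [].
  by move=> /(_ (1 *: x0, 1 * q x0)); apply; exists 1.
have [u Gu] := Gn0; have G0 : G (0, 0).
  by move: u Gu => [x a]; exact: linear_graph0.
have Gtot z : exists a, G (z, a).
  apply: contrapT => Gz; have [c domc] := dominated_adjoin z Gn0 linG domG.
  have subG : G `<=` adjoin G z c.
    move=> [y b] Gyb; exists (y, b) => //; exists 0 => //=.
    by rewrite scale0r mul0r !addr0.
  apply: (maxG (adjoin G z c)).
    split=> // /(_ (z, c)) Gzc; apply: Gz; exists c; apply: Gzc.
    by exists (0, 0) => //; exists 1; rewrite //= scale1r mul1r !add0r.
  split=> //; first exact: linear_graph_adjoin.
  by move=> _; exact/subG/G1.
have [f Gf] := choice Gtot.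
have Gfun z a : G (z, a) -> a = f z.
  (* Domination at [(0, d)] and at [(0, - d)] forces [d = 0], so the graph is single-valued. *)
  move=> Gza; pose d := a - f z.
  have Gd : G (0, d).
    by have := linG _ _ _ _ (-1) Gza (Gf z); rewrite scaleN1r subrr mulN1r.
  have d1 := domG _ _ Gd; have d2 := domG _ _ (linear_graphZ (-1) linG Gd).
  move: d1 d2; rewrite scaler0 q0 /d; lra.
exists f; split.
- by move=> x y r; apply/esym/Gfun/linG; exact: Gf.
- by move=> x; exact: domG.
- by apply/esym/Gfun/G1.
Qed.

End HahnBanachReal.

(** * The real and complex scalar fields *)

Section Scalars.
Context {R : realType} (c : scalar_kind).
Local Notation K := (scalar_field R c).

Lemma of_real_is_zmod_morphism : zmod_morphism (@of_real R c).
Proof. by case: c => //= x y; rewrite rmorphB. Qed.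

Lemma of_real_is_monoid_morphism : monoid_morphism (@of_real R c).
Proof. by case: c => //=; split=> [|x y]; rewrite ?rmorph1 ?rmorphM. Qed.

HB.instance Definition _ := GRing.isZmodMorphism.Build R K (@of_real R c)
  of_real_is_zmod_morphism.
HB.instance Definition _ := GRing.isMonoidMorphism.Build R K (@of_real R c)
  of_real_is_monoid_morphism.

Lemma ler_of_real (x y : R) : (of_real c x <= of_real c y) = (x <= y).
Proof. by case: c => //=; exact: lecR. Qed.

Lemma ltr_of_real (x y : R) : (of_real c x < of_real c y) = (x < y).
Proof. by case: c => //=; exact: ltcR. Qed.

Lemma modulus_of_real (r : R) : modulus (of_real c r) = `|r|.
Proof. by case: c => //=; rewrite expr0n addr0 sqrtr_sqr. Qed.

Lemma modulus_ge0 (a : K) : 0 <= modulus a.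
Proof. by rewrite -ler_of_real of_real_modulus rmorph0. Qed.

Lemma modulusM (a b : K) : modulus (a * b) = modulus a * modulus b.
Proof. by case: c a b => /= a b; [exact: normrM|exact: Normc.normcM]. Qed.

Lemma modulus_le1 (a : K) : (modulus a <= 1) = (`|a| <= 1).
Proof. by rewrite -of_real_modulus -ler_of_real rmorph1. Qed.

(** In the complex case the order hypotheses force [a] to be real. *)
Lemma modulus_onem (a : K) : 0 <= a -> a <= 1 -> modulus (1 - a) = 1 - modulus a.
Proof.
move=> a0 a1; have aE : of_real c (1 - modulus a) = 1 - a.
  rewrite rmorphB rmorph1; congr (1 - _).
  exact: etrans (of_real_modulus a) (ger0_norm a0).
apply/le_anti; rewrite -!ler_of_real of_real_modulus aE.
by rewrite ger0_norm ?subr_ge0// lexx.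
Qed.

End Scalars.

(** A copy of the space that carries its real vector space structure, so that the real Hahn-Banach
    theorem applies over both fields. *)
Definition restrict_scalars (R : realType) (c : scalar_kind)
  (X : lmodType (scalar_field R c)) : Type := X.

Section RestrictScalars.
Context {R : realType} {c : scalar_kind} (X : lmodType (scalar_field R c)).

HB.instance Definition _ := GRing.Zmodule.copy (restrict_scalars X) X.

Definition real_scale (r : R) (x : restrict_scalars X) : restrict_scalars X :=
  of_real c r *: (x : X).

Fact real_scaleA a b x : real_scale a (real_scale b x) = real_scale (a * b) x.
Proof. by rewrite /real_scale scalerA rmorphM. Qed.

Fact real_scale1 : left_id 1 real_scale.
Proof. by move=> x; rewrite /real_scale rmorph1 scale1r. Qed.

Fact real_scaleDr : right_distributive real_scale +%R.
Proof. by move=> a x y; exact: scalerDr. Qed.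

Fact real_scaleDl x : {morph real_scale^~ x : a b / a + b}.
Proof. by move=> a b; rewrite /real_scale rmorphD; exact: scalerDl. Qed.

HB.instance Definition _ := GRing.Zmodule_isLmodule.Build R (restrict_scalars X)
  real_scaleA real_scale1 real_scaleDr real_scaleDl.

End RestrictScalars.

(** * Seminorms and norming functionals *)

Section Seminorms.
Context {R : realType} {c : scalar_kind} {X : tvsType (scalar_field R c)}.
Variable p : X -> R.
Hypothesis p_semi : seminorm p.

Lemma seminormZ (r : R) x : p (of_real c r *: x) = `|r| * p x.
Proof. by rewrite (proj2 p_semi) modulus_of_real. Qed.

Lemma seminorm0 : p 0 = 0.
Proof. by rewrite -(scale0r (0 : X)) -(rmorph0 (of_real c)) seminormZ normr0 mul0r. Qed.

Lemma seminormN x : p (- x) = p x.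
Proof.
have -> : - x = of_real c (-1) *: x by rewrite rmorphN rmorph1 scaleN1r.
by rewrite seminormZ normrN1 mul1r.
Qed.

Lemma seminorm_ge0 x : 0 <= p x.
Proof.
have := proj1 p_semi x (- x); rewrite subrr seminorm0 seminormN; lra.
Qed.

Lemma seminormB x y : p (x - y) <= p x + p y.
Proof. by rewrite -(seminormN y); exact: (proj1 p_semi). Qed.

End Seminorms.

Lemma hahn_banach (R : realType) (c : scalar_kind) (X : tvsType (scalar_field R c))
    (q : X -> R) (x0 : X) : seminorm q ->
  exists phi : {linear X -> (scalar_field R c)^o},
    (forall x, modulus (phi x) <= q x) /\ modulus (phi x0) = q x0.
Proof.
move=> q_semi.
have [||f [f_lin f_le fx0]] := @hahn_banach_real R (restrict_scalars X) q _ _ x0.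
- exact: (proj1 q_semi).
- by move=> r x r0; rewrite [LHS](seminormZ q_semi) gtr0_norm.
have fD x y : f ((x : X) + y) = f x + f y.
  by have := f_lin x y 1; rewrite scale1r mul1r.
have fZ (r : R) (x : X) : f (of_real c r *: x) = r * f x.
  have f0 : f 0 = 0 by have := fD 0 0; rewrite addr0; lra.
  by have := f_lin 0 x r; rewrite f0 !add0r.
have fN x : f (- x) = - f x.
  have -> : - x = of_real c (-1) *: x by rewrite rmorphN rmorph1 scaleN1r.
  by rewrite fZ mulN1r.
case: c X q x0 q_semi f {f_lin} f_le fx0 fD fZ fN
    => X q x0 q_semi f f_le fx0 fD fZ fN.
  have phi_lin : linear (f : X -> R^o).
    by move=> a x y; rewrite fD fZ.
  pose phiM := GRing.isLinear.Build R X R^o _ (f : X -> R^o) phi_lin.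
  pose phi : {linear X -> R^o} := HB.pack (f : X -> R^o) phiM.
  exists phi => /=; split=> [x|].
    by rewrite ler_norml f_le andbT lerNl -fN -(seminormN q_semi).
  by rewrite fx0 ger0_norm// seminorm_ge0.
(* The complex linear functional with real part [f] is [f x - i f (i x)]. *)
pose g (x : X) : R[i] := (f x +i* - f ('i%C *: x))%C.
have g_lin : linear (g : X -> R[i]^o).
  move=> [a b] x y.
  have abE z : (a +i* b)%C *: (z : X) =
      of_real ComplexScalars a *: z + of_real ComplexScalars b *: ('i%C *: z).
    by rewrite scalerA -scalerDl /=; congr (_ *: _); simpc.
  have iE z : 'i%C *: ('i%C *: (z : X)) = - z.
    by rewrite scalerA -expr2 sqr_i scaleN1r.
  rewrite /g; apply/eqP; rewrite eq_complex /=; apply/andP; split; apply/eqP.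
    by rewrite fD abE fD !fZ mulrN opprK.
  rewrite scalerDr fD scalerA mulrC -scalerA abE fD !fZ iE fN; ring.
pose phiM := GRing.isLinear.Build R[i] X R[i]^o _ (g : X -> R[i]^o) g_lin.
pose phi : {linear X -> R[i]^o} := HB.pack (g : X -> R[i]^o) phiM.
have phi_le x : modulus (c := ComplexScalars) (phi x) <= q x.
  have [->|gx0] := eqVneq (phi x) 0.
    by rewrite /= expr0n addr0 sqrtr0 seminorm_ge0.
  (* Rotating [x] by the unimodular [a] makes the value of [phi] real and nonnegative, hence a value
     of [f], which [q] dominates. *)
  pose a : R[i] := `|phi x| / phi x.
  have a1 : modulus (c := ComplexScalars) a = 1.
    apply: (@complexI R); rewrite -/(of_real ComplexScalars _) of_real_modulus.
    by rewrite /a normrM normfV normr_id divff ?normr_eq0.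
  have : phi (a *: x) = `|phi x| by rewrite linearZ; exact: divfK.
  rewrite -(of_real_modulus (c := ComplexScalars)) => /(congr1 (@complex.Re R)) /= <-.
  by apply: le_trans (f_le _) _; rewrite (proj2 q_semi) a1 mul1r.
exists phi; split=> //; apply/eqP; rewrite eq_le phi_le /= -fx0.
by apply: le_trans (ler_norm _) _; rewrite -sqrtr_sqr ler_wsqrtr// lerDl sqr_ge0.
Qed.

(** * Infimal convolution of two seminorms *)

Section InfimalConvolution.
Context {R : realType} {c : scalar_kind} {X : tvsType (scalar_field R c)}.

(** For seminorms this is the largest seminorm below both; a functional dominated by it is
    controlled by [p0] and [p1] simultaneously. *)
Definition inf_conv (p0 p1 : X -> R) (x : X) : R :=
  inf [set p1 u + p0 (x - u) | u in [set: X]].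

Variables p0 p1 : X -> R.
Hypotheses (p0_semi : seminorm p0) (p1_semi : seminorm p1).

Lemma inf_conv_le x u : inf_conv p0 p1 x <= p1 u + p0 (x - u).
Proof.
apply: ge_inf; last by exists u.
by exists 0 => _ [v _ <-]; rewrite addr_ge0 ?seminorm_ge0.
Qed.

Lemma le_inf_conv x b : (forall u, b <= p1 u + p0 (x - u)) -> b <= inf_conv p0 p1 x.
Proof.
move=> hb; apply: lb_le_inf; first by exists (p1 0 + p0 (x - 0)); exists 0.
by move=> _ [u _ <-].
Qed.

Lemma inf_conv_near x e : 0 < e -> exists u, p1 u + p0 (x - u) < inf_conv p0 p1 x + e.
Proof.
move=> e0; apply: contrapT => hu.
have : inf_conv p0 p1 x + e <= inf_conv p0 p1 x.
  by apply: le_inf_conv => u; rewrite leNgt; apply/negP => ?; apply: hu; exists u.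
lra.
Qed.

Lemma inf_conv_lel x : inf_conv p0 p1 x <= p0 x.
Proof. by have := inf_conv_le x 0; rewrite subr0 (seminorm0 p1_semi) add0r. Qed.

Lemma inf_conv_ler x : inf_conv p0 p1 x <= p1 x.
Proof. by have := inf_conv_le x x; rewrite subrr (seminorm0 p0_semi) addr0. Qed.

Lemma inf_conv_seminorm : seminorm (inf_conv p0 p1).
Proof.
have ge0 x : 0 <= inf_conv p0 p1 x.
  by apply: le_inf_conv => u; rewrite addr_ge0 ?seminorm_ge0.
split=> [x y|].
  rewrite -lerBlDr; apply: le_inf_conv => u; rewrite lerBlDr -lerBlDl.
  apply: le_inf_conv => v; rewrite lerBlDl.
  apply: le_trans (inf_conv_le _ (u + v)) _.
  have := proj1 p1_semi u v; have := proj1 p0_semi (x - u) (y - v).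
  rewrite addrACA -opprD; lra.
have inf_convZ a x : inf_conv p0 p1 (a *: x) <= modulus a * inf_conv p0 p1 x.
  have [a0|] := ltP 0 (modulus a); last first.
    move=> a0; have {}a0 : modulus a = 0 by apply/le_anti; rewrite a0 modulus_ge0.
    by rewrite a0 mul0r (le_trans (inf_conv_lel _))// (proj2 p0_semi) a0 mul0r.
  rewrite -ler_pdivrMl//; apply: le_inf_conv => u; rewrite ler_pdivrMl// mulrDr.
  by rewrite -(proj2 p0_semi) -(proj2 p1_semi) scalerBr inf_conv_le.
move=> a x; apply/le_anti; rewrite inf_convZ /=.
have [->|a0] := eqVneq a 0.
  by rewrite -(rmorph0 (of_real c)) modulus_of_real normr0 mul0r ge0.
have := inf_convZ a^-1 (a *: x); rewrite scalerA mulVf// scale1r => h.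
apply: le_trans (ler_wpM2l (modulus_ge0 a) h) _.
rewrite mulrA -modulusM mulfV// -(rmorph1 (of_real c)) modulus_of_real normr1.
by rewrite mul1r.
Qed.

End InfimalConvolution.

(** * Fundamental systems of seminorms and continuity of functionals *)

Section FundamentalSeminorms.
Context {R : realType} {c : scalar_kind} {X : tvsType (scalar_field R c)}.
Local Notation K := (scalar_field R c).
Variable p : nat -> X -> R.
Hypothesis p_fund : fundamental_seminorms p.

Lemma fundamental_seminorm k : seminorm (p k).
Proof. by case: p_fund. Qed.

Lemma fundamental_mono i j x : (i <= j)%N -> p i x <= p j x.
Proof.
case: p_fund => _ p_incr _ /subnKC <-.
by elim: (j - i)%N => [|n IHn]; rewrite ?addn0// addnS (le_trans IHn).
Qed.

Lemma fundamental_nbhs x (U : set X) :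
  nbhs x U <-> exists k, exists2 e : R, 0 < e & [set y | p k (y - x) < e] `<=` U.
Proof.
case: p_fund => _ _ fund0; split.
  move=> /(nbhsB (- x)); rewrite addNr => /fund0[k [e e0 ekU]].
  exists k, e => // y /= /ekU[u Uu]; rewrite [y - x]addrC => /addrI.
  by move=> <-.
move=> [k [e e0 ekU]].
have /(nbhsT x) : nbhs (0 : X) [set y | p k y < e] by apply/fund0; exists k, e.
apply: filterS => _ [y pky <-]; apply: ekU.
by rewrite /= addrAC subrr add0r.
Qed.

Lemma seminorm_bounded_continuous (phi : {linear X -> K^o}) k (M : R) :
  (forall x, modulus (phi x) <= M * p k x) -> continuous (phi : X -> K^o).
Proof.
move=> phiM x; apply/cvgrPdist_lt => e e0; apply/fundamental_nbhs.
have e_real : of_real c (modulus e) = e by rewrite of_real_modulus gtr0_norm.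
have {}e0 : 0 < modulus e by rewrite -(ltr_of_real c) e_real rmorph0.
exists k, (modulus e / (`|M| + 1)) => [|y]; first by rewrite divr_gt0// ltr_pwDr.
rewrite /= ltr_pdivlMr ?ltr_pwDr// => pky.
rewrite -normrN opprB -linearB -of_real_modulus -e_real ltr_of_real.
apply: le_lt_trans (phiM _) (le_lt_trans _ pky).
rewrite mulrC ler_wpM2l ?seminorm_ge0//; first exact: fundamental_seminorm.
by rewrite (le_trans (ler_norm _))// lerDl.
Qed.

End FundamentalSeminorms.

(** * From the dual inequality to decompositions of unit balls *)

Section Decomposition.
Context {R : realType} {c : scalar_kind} {X : tvsType (scalar_field R c)}.
Local Notation K := (scalar_field R c).
Variable p : nat -> X -> R.
Hypotheses (p_fund : fundamental_seminorms p) (p_Omega : Omega_bar p).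

Let p_semi := fundamental_seminorm p_fund.

Lemma dual_norm_le (q : X -> R) (phi : X -> K) (M : R) : 0 <= M ->
  (forall x, modulus (phi x) <= M * q x) -> (dual_norm q phi <= M%:E)%E.
Proof.
move=> M0 phiM; apply: ge_ereal_sup => _ [x /= qx1 <-]; rewrite lee_fin.
by rewrite (le_trans (phiM x))// ler_piMr.
Qed.

(* The Hahn-Banach functional norming [x] for the infimal convolution of
   [r * p k] and [r^-1 * p m] has dual norms at most [r] and [r^-1]. *)
Lemma Omega_bar_decomposition k : exists2 l, (k <= l)%N &
  forall m, exists2 C : R, 0 < C & forall (r : R) x, 0 < r -> p l x <= 1 ->
    exists u, p m u <= C * r /\ p k (x - u) <= C / r.
Proof.
have [l kl Oml] := p_Omega k; exists l => // m.
(* [Omega_bar] only speaks of indices from [l] on; a bound for the larger index [maxn l m] also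
   bounds [p m]. *)
have [|C C0 OmC] := Oml (maxn l m); first exact: leq_maxl.
(* From [q x * q x <= C] follows [q x <= C + 1]; the remaining 1 is the slack in the choice of a
   nearly optimal [u]. *)
exists (C + 2) => [|r x r0 plx]; first lra.
have scaled_semi (s : R) (q : X -> R) : 0 <= s -> seminorm q ->
    seminorm (fun x => s * q x).
  move=> s0 [qD qZ]; split=> [y z|a y]; first by rewrite -mulrDr ler_wpM2l.
  by rewrite qZ mulrCA.
have s0 := scaled_semi _ _ (ltW r0) (p_semi k).
have r'0 : 0 < r^-1 by rewrite invr_gt0.
have s1 := scaled_semi _ _ (ltW r'0) (p_semi (maxn l m)).
set q0 := fun _ => _ in s0; set q1 := fun _ => _ in s1.
have [phi [phi_le phix]] := hahn_banach x (inf_conv_seminorm s0 s1).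
set q := inf_conv q0 q1 in phi_le phix.
have phi_cont : continuous (phi : X -> K^o).
  apply: (seminorm_bounded_continuous p_fund (k := k) (M := r)) => y.
  exact: le_trans (phi_le y) (inf_conv_lel s0 s1 y).
have dk : (dual_norm (p k) phi <= r%:E)%E.
  apply: dual_norm_le => [|y]; first exact: ltW.
  exact: le_trans (phi_le y) (inf_conv_lel s0 s1 y).
have dm : (dual_norm (p (maxn l m)) phi <= r^-1%:E)%E.
  apply: dual_norm_le => [|y]; first exact: ltW.
  exact: le_trans (phi_le y) (inf_conv_ler s0 s1 y).
have dl : ((q x)%:E <= dual_norm (p l) phi)%E.
  by rewrite -phix; apply: ereal_sup_ubound; exists x.
have d0 (q' : X -> R) : seminorm q' -> (0 <= dual_norm q' phi)%E.
  move=> q'_semi; apply: ereal_sup_ubound; exists 0; first by rewrite /= seminorm0.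
  by rewrite linear0 -(rmorph0 (of_real c)) modulus_of_real normr0.
have qx0 : 0 <= q x by apply: seminorm_ge0; exact: inf_conv_seminorm.
have qC : q x * q x <= C.
  rewrite -lee_fin EFinM; apply: le_trans (lee_pmul _ _ dl dl) _; rewrite ?lee_fin//.
  rewrite -expe2; apply: le_trans (OmC phi phi_cont) _.
  rewrite -muleA -[leRHS]mule1; apply: lee_wpmul2l; first by rewrite lee_fin ltW.
  have -> : 1%E = (r%:E * r^-1%:E)%E by rewrite -EFinM divff// gt_eqF.
  exact: lee_pmul (d0 _ (p_semi _)) (d0 _ (p_semi _)) dk dm.
have [u] := inf_conv_near q0 q1 x (@ltr01 R); rewrite -/q => hu.
have {}hu : q1 u + q0 (x - u) <= C + 2 by nra.
have q0u := seminorm_ge0 s0 (x - u); have q1u := seminorm_ge0 s1 u.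
exists u; split.
  apply: (le_trans (fundamental_mono p_fund _ (leq_maxr l m))).
  by rewrite -ler_pdivrMr// mulrC -/(q1 u); lra.
by rewrite ler_pdivlMr// mulrC -/(q0 (x - u)); lra.
Qed.

(* Two successive steps turn the exponent 1/2 of the interpolation inequality
   into 3/4; the gain absorbs the constant, which depends on [m]. *)
Lemma Omega_bar_absorption k : exists2 l, (k <= l)%N &
  forall m, exists2 T : R, 0 < T & forall (t : R) x, T <= t -> p l x <= 1 ->
    exists u, p m u <= t /\ p k (x - u) <= t^-1.
Proof.
have [l1 kl1 dec1] := Omega_bar_decomposition k.
have [l2 l12 dec2] := Omega_bar_decomposition l1.
exists l2 => [|m]; first exact: leq_trans l12.
have [C1 C10 {}dec1] := dec1 m; have [C2 C20 {}dec2] := dec2 m.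
(* The two pieces have [p m] at most [C2 * r] and [C2 * C1 * r], in total [D * r], which is [t] for
   [r = t / D]. *)
pose D := C2 * (1 + C1).
have D0 : 0 < D by rewrite mulr_gt0// addr_gt0.
have CD0 : 0 < C1 * C2 * D by apply: mulr_gt0 => //; exact: mulr_gt0.
(* The error in [p k] will be [C1 * C2 / r ^+ 3], which is at most [(D * r)^-1] once
   [C1 * C2 * D <= r ^+ 2]; the threshold ensures this. *)
exists (D * (C1 * C2 * D + 1)) => [|t x Tt pl2x].
  by rewrite mulr_gt0// ltr_pwDr// ltW.
pose r := t / D.
have rT : C1 * C2 * D + 1 <= r by rewrite ler_pdivlMr// mulrC.
have r0 : 0 < r by lra.
have tE : t = D * r by rewrite mulrC divfK// gt_eqF.
have [u2 [mu2 l1u2]] := dec2 r x r0 pl2x.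
have rC0 : 0 < r / C2 by rewrite divr_gt0.
pose y := of_real c (r / C2) *: (x - u2).
have l1y : p l1 y <= 1.
  rewrite (seminormZ (p_semi _)) gtr0_norm// mulrC mulrA ler_pdivrMr// mul1r.
  by rewrite -ler_pdivlMr.
(* With the parameter [r ^+ 2], scaling back by [C2 / r] leaves order [r] in [p m] and order
   [r ^- 3] in [p k]. *)
have [u1 [mu1 ku1]] := dec1 (r ^+ 2) y (exprn_gt0 2 r0) l1y.
exists (u2 + of_real c (C2 / r) *: u1).
have Cr0 : 0 < C2 / r by rewrite divr_gt0.
split.
  apply: le_trans (proj1 (p_semi m) _ _) _.
  rewrite (seminormZ (p_semi _)) gtr0_norm// tE /D.
  have : C2 / r * p m u1 <= C2 / r * (C1 * r ^+ 2) by rewrite ler_pM2l.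
  have -> : C2 / r * (C1 * r ^+ 2) = C2 * C1 * r by field; rewrite gt_eqF.
  lra.
have -> : x - (u2 + of_real c (C2 / r) *: u1) = of_real c (C2 / r) *: (y - u1).
  rewrite scalerBr /y scalerA -rmorphM opprD addrA.
  by rewrite mulrA divfK ?gt_eqF// divff ?gt_eqF// rmorph1 scale1r.
rewrite (seminormZ (p_semi _)) gtr0_norm//.
apply: (@le_trans _ _ (C2 / r * (C1 / r ^+ 2))); first by rewrite ler_pM2l.
rewrite tE -[leRHS]mul1r ler_pdivlMr; last exact: mulr_gt0.
have -> : C2 / r * (C1 / r ^+ 2) * (D * r) = C1 * C2 * D / r ^+ 2.
  by field; rewrite gt_eqF.
by rewrite ler_pdivrMr ?exprn_gt0//; nra.
Qed.

End Decomposition.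

(** An index can tend to infinity so slowly that its threshold [N], however fast it grows, stays
    below [s]: take the largest [i <= s] with [N i <= s]. The bound [N 0 <= s] covers the default
    value 0 of the maximum. *)
Lemma slow_index (N : nat -> nat) : exists m : nat -> nat,
  forall M, exists S, forall s, (S <= s)%N -> (M <= m s)%N /\ (N (m s) <= s)%N.
Proof.
exists (fun s => \max_(i < s.+1 | (N i <= s)%N) i)%N => M.
exists (maxn (N 0) (maxn (N M) M))%N => s; rewrite !geq_max => /and3P[N0s NMs Ms].
split; last by elim/big_ind : _ => // a b Na Nb; rewrite /maxn; case: ifP.
rewrite -ltnS in Ms.
exact: (@leq_bigmax_cond _ (fun i : 'I_s.+1 => (N i <= s)%N) (fun i => i : nat)
  (Ordinal Ms) NMs).
Qed.

(** * Mittag-Leffler corrections and the radii of the bounded set *)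

Section Radii.
Context {R : realType} {c : scalar_kind} {X : tvsType (scalar_field R c)}.

Definition absorbing_seminorms (q : nat -> X -> R) : Prop :=
  forall i m, exists2 T : R, 0 < T & forall (t : R) x, T <= t -> q i.+1 x <= 1 ->
    exists u, q m u <= t /\ q i (x - u) <= t^-1.

Lemma Omega_bar_subsequence (p : nat -> X -> R) :
  fundamental_seminorms p -> Omega_bar p ->
  exists q : nat -> X -> R, fundamental_seminorms q /\ absorbing_seminorms q.
Proof.
move=> p_fund p_Omega.
have /choice[L LP] k : exists l, (k <= l)%N /\
    forall m, exists2 T : R, 0 < T & forall (t : R) x, T <= t -> p l x <= 1 ->
      exists u, p m u <= t /\ p k (x - u) <= t^-1.
  by have [l ? ?] := Omega_bar_absorption p_fund p_Omega k; exists l.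
(* The successor makes [kappa] strictly increasing, so the subsequence is still fundamental. *)
pose kappa := fix kappa i := if i is j.+1 then (L (kappa j)).+1 else 0%N.
have kappa_ge i : (i <= kappa i)%N.
  elim: i => //= i IHi; rewrite ltnS (leq_trans IHi)//.
  by have [] := LP (kappa i).
exists (fun i => p (kappa i)); split.
  split=> [k|k x|U]; first exact: fundamental_seminorm.
    apply: fundamental_mono => //=; rewrite ltnW// ltnS.
    by have [] := LP (kappa k).
  case: (p_fund) => _ _ ->; split=> -[k [e e0 kU]]; last by exists (kappa k), e.
  exists k, e => // x /= kx; apply: kU.
  exact: le_lt_trans (fundamental_mono p_fund x (kappa_ge k)) kx.
move=> i m; have [_ /(_ (kappa m))[T T0 TP]] := LP (kappa i).
exists T => // t x Tt qx; apply: TP => //.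
by rewrite (le_trans _ qx)//= fundamental_mono.
Qed.

Variable q : nat -> X -> R.
Hypotheses (X_complete : tvs_complete X) (q_fund : fundamental_seminorms q).
Let q_semi := fundamental_seminorm q_fund.

Lemma seminorm_dist k x y z : q k (x - z) <= q k (x - y) + q k (y - z).
Proof. by rewrite -[x - z](subrKA y) (proj1 (q_semi k)). Qed.

(** The increments are summable in every seminorm, since the index grows along with the sequence;
    the geometric tail bounds the distance to the limit. *)
Lemma telescoping_limit (x : nat -> X) M (e : R) : 0 < e ->
  (forall n, q (M + n) (x n - x n.+1) <= e / 2 ^+ n) ->
  exists b, forall n, q (M + n) (x n - b) <= 2 * e / 2 ^+ n.
Proof.
move=> e0 xP.
have tele n i : q (M + n) (x n - x (n + i)%N) <= 2 * e / 2 ^+ n - 2 * e / 2 ^+ (n + i).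
  elim: i => [|i IHi]; first by rewrite addn0 !subrr (seminorm0 (q_semi _)).
  apply: le_trans (seminorm_dist _ _ (x (n + i)%N) _) _.
  have := le_trans (fundamental_mono q_fund _ _) (xP (n + i)%N).
  move=> /(_ (M + n)%N); rewrite addnA leq_addr => /(_ isT); rewrite addnS.
  have -> : 2 * e / 2 ^+ (n + i).+1 = e / 2 ^+ (n + i).
    by rewrite exprS invfM mulrACA divff ?mul1r// pnatr_eq0.
  have {}IHi : q (M + n) (x n - x (n + i)%N) <=
      2 * e / 2 ^+ n - (e / 2 ^+ (n + i) + e / 2 ^+ (n + i)).
    by move: IHi; rewrite -(mulrA 2 e (2 ^+ (n + i))^-1) [2 * (e / _)]mulr_natl mulr2n.
  lra.
have tail n i : (n <= i)%N -> q (M + n) (x n - x i) <= 2 * e / 2 ^+ n.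
  move=> /subnKC <-; apply: le_trans (tele n _) _.
  by rewrite lerBlDr lerDl divr_ge0 ?exprn_ge0// mulr_ge0// ltW.
have [|b xb] := @X_complete (x @ \oo) _.
  move=> U /(fundamental_nbhs q_fund)[k [d d0 kU]].
  (* Beyond [N] the seminorm of index [k] is controlled, and two tails of size [2 * e / 2 ^+ N]
     together stay below [d]. *)
  pose N := (k + Num.bound (4 * e / d))%N.
  have hN : 4 * e / 2 ^+ N < d.
    rewrite ltr_pdivrMr ?exprn_gt0// [d * _]mulrC -ltr_pdivrMr//.
    have /archi_boundP/lt_trans -> // : 0 <= 4 * e / d.
      by rewrite divr_ge0 ?mulr_ge0 ?ltW.
    by rewrite -natrX ltr_nat (leq_ltn_trans (leq_addl k _))// ltn_expl.
  exists [set x i | i in [set i | (N <= i)%N]].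
    by exists N => // i /= Ni; exists i.
  move=> _ _ [i /= Ni <-] [j /= Nj <-]; apply: kU => /=; rewrite subr0.
  apply: le_lt_trans _ hN.
  have kN : (k <= M + N)%N by rewrite /N addnCA leq_addr.
  apply: le_trans (fundamental_mono q_fund _ kN) _.
  apply: le_trans (seminorm_dist _ _ (x N) _) _.
  rewrite -(seminormN (q_semi _)) opprB.
  have := tail N i Ni; have := tail N j Nj; rewrite -!mulrA; lra.
exists b => n; rewrite leNgt; apply/negP => hlt.
pose d := q (M + n) (x n - b) - 2 * e / 2 ^+ n.
have d0 : 0 < d by rewrite subr_gt0.
have : nbhs b [set y | q (M + n) (y - b) < d].
  by apply/(fundamental_nbhs q_fund); exists (M + n)%N, d.
move=> /xb[N _ NP]; have /= := NP (maxn n N) (leq_maxr _ _).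
have := seminorm_dist (M + n) (x n) (x (maxn n N)) b.
have := tail n _ (leq_maxl n N); rewrite /d; lra.
Qed.

Hypothesis q_abs : absorbing_seminorms q.

(** A quasinormability condition: the error [e] is arbitrary and only [r] pays for it. This drives
    the Mittag-Leffler iteration. *)
Lemma quasinormable_step i (a e : R) : 0 < a -> 0 < e -> exists2 r : R, 0 < r &
  forall x, q i.+1 x <= a -> exists u, q i.+2 u <= r /\ q i (x - u) <= e.
Proof.
move=> a0 e0; have [T T0 TP] := q_abs i i.+2.
(* After scaling by [a] the error is [a / t], hence at most [e]. *)
pose t := Num.max T (a / e).
have t0 : 0 < t by rewrite lt_max T0.
exists (a * t) => [|x qx]; first exact: mulr_gt0.
have [||u [u1 u2]] := TP t (of_real c a^-1 *: x).
- by rewrite le_max lexx.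
- by rewrite (seminormZ (q_semi _)) gtr0_norm ?invr_gt0// ler_pdivrMl// mulr1.
exists (of_real c a *: u); split.
  by rewrite (seminormZ (q_semi _)) gtr0_norm// ler_pM2l.
have -> : x - of_real c a *: u = of_real c a *: (of_real c a^-1 *: x - u).
  by rewrite scalerBr scalerA -rmorphM divff ?gt_eqF// rmorph1 scale1r.
rewrite (seminormZ (q_semi _)) gtr0_norm//.
apply: (@le_trans _ _ (a / t)); first by rewrite ler_pM2l.
by rewrite ler_pdivrMr// mulrC -ler_pdivrMr// le_max lexx orbT.
Qed.

(** Mittag-Leffler argument: [x] is replaced successively by points bounded in ever higher
    seminorms, with errors summing to at most [s^-1]. The limit is bounded in all of them, with
    radii independent of [x]. *)
Lemma bounded_correction M (s : R) : 0 < s -> exists r : nat -> R,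
  forall x, q M.+1 x <= s ->
    exists b, (forall j, q j b <= r j) /\ q M (x - b) <= s^-1.
Proof.
move=> s0; pose e := s^-1 / 2.
have e0 : 0 < e by rewrite divr_gt0 ?invr_gt0.
have en0 n : 0 < e / 2 ^+ n by rewrite divr_gt0 ?exprn_gt0.
have /choice[r rP] (z : nat * R) : exists r : R, 0 < z.2 -> 0 < r /\
    forall x, q (M + z.1).+1 x <= z.2 ->
      exists u, q (M + z.1).+2 u <= r /\ q (M + z.1) (x - u) <= e / 2 ^+ z.1.
  have [z0|] := ltP 0 z.2; last by exists 0.
  by have [r ? ?] := quasinormable_step (M + z.1) z0 (en0 z.1); exists r.
(* The radii are fixed before any point is chosen, which makes them uniform in [x]. *)
pose a := fix a n := if n is n'.+1 then r (n', a n') else s.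
have a0 n : 0 < a n by elim: n => //= n IHn; have [] := rP (n, a n) IHn.
exists (fun j => a j + s^-1) => x0 qx0.
have /choice[g gP] (z : nat * X) : exists u, q (M + z.1).+1 z.2 <= a z.1 ->
    q (M + z.1).+2 u <= a z.1.+1 /\ q (M + z.1) (z.2 - u) <= e / 2 ^+ z.1.
  have [_ rz] := rP (z.1, a z.1) (a0 z.1).
  have [/rz[u ?]|] := boolP (q (M + z.1).+1 z.2 <= a z.1); first by exists u.
  by exists 0.
pose x := fix x n := if n is n'.+1 then g (n', x n') else x0.
have qx n : q (M + n).+1 (x n) <= a n.
  elim: n => [|n IHn] /=; first by rewrite addn0.
  by have [] := gP (n, x n) IHn; rewrite addnS.
have [|b bP] := telescoping_limit (x := x) (M := M) e0.
  by move=> n; have [] := gP (n, x n) (qx n).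
have eE : 2 * e = s^-1 by rewrite /e mulrC divfK.
exists b; split=> [j|]; last by have := bP 0%N; rewrite addn0 eE expr0 divr1.
rewrite -[b](subKr (x j)); apply: le_trans (seminormB (q_semi _) _ _) _.
apply: lerD.
  apply: le_trans (qx j); apply: (fundamental_mono q_fund).
  by rewrite ltnW// ltnS leq_addl.
apply: le_trans (fundamental_mono q_fund _ (leq_addl M j)) _.
apply: le_trans (bP j) _; rewrite eE ler_pdivrMr ?exprn_gt0//.
by rewrite ler_peMr ?invr_ge0 ?(ltW s0)// exprn_ege1// ler1n.
Qed.

(* [x] in the unit ball of [q k.+1] is first approximated in [s] times the unit
   ball of [q (m s)], with [m s] tending to infinity; the correction then spoils
   the bound on [q j] for the finitely many [s] with [m s <= j] only. *)
Lemma prominent_radii : exists rho : nat -> R, (forall j, 0 < rho j) /\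
  forall k, exists2 S, (0 < S)%N & forall s, (S <= s)%N -> forall x, q k.+1 x <= 1 ->
    exists b, (forall j, q j b <= s%:R * rho j) /\ q k (x - b) <= 2 / s%:R.
Proof.
have /choice[T TP] (z : nat * nat) : exists T : R, 0 < T /\
    forall (t : R) x, T <= t -> q z.1.+1 x <= 1 ->
      exists u, q z.2 u <= t /\ q z.1 (x - u) <= t^-1.
  by have [T ? ?] := q_abs z.1 z.2; exists T.
(* Taking the maximum over [k] gives [T (k, m s) <= s] for all [k <= m s] at once. *)
have [m mP] := slow_index (fun m => \max_(k < m.+1) Num.bound (T (nat_of_ord k, m)))%N.
have /choice[r rP] (s : nat) : exists r : nat -> R, (0 < s)%N ->
    forall x, q (m s).-1.+1 x <= s%:R ->
      exists b, (forall j, q j b <= r j) /\ q (m s).-1 (x - b) <= s%:R^-1.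
  have [->|s0] := posnP s; first by exists (fun=> 0).
  have [|r ?] := @bounded_correction (m s).-1 s%:R; first by rewrite ltr0n.
  by exists r.
have /choice[S SP] j := mP j.+1.
(* The 2 serves the indices [j < m s], where [q j b <= s + s^-1 <= 2 * s]; the sum serves
   [m s <= j], which forces [s < S j]. *)
pose rho j : R := 2 + \sum_(s < S j) `|r s j|.
have rho2 j : 2 <= rho j by rewrite lerDl sumr_ge0.
exists rho; split=> [j|k]; first exact: lt_le_trans (rho2 j).
exists (S k).+1 => // s Ss x qx.
have s0 : (0 < s)%N by exact: leq_ltn_trans Ss.
have s1 : 1 <= s%:R :> R by rewrite ler1n.
have [kms msP] := SP k s (ltnW Ss).
have ms : (m s).-1.+1 = m s by rewrite prednK// (leq_trans _ kms).
have kms1 : (k <= (m s).-1)%N by rewrite -ltnS ms.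
have [T0 {}TP] := TP (k, m s).
have Ts : T (k, m s) <= s%:R.
  apply: le_trans (ltW (archi_boundP (ltW T0))) _; rewrite ler_nat.
  apply: leq_trans _ msP; have km : (k < (m s).+1)%N by exact: ltnW.
  exact: (@leq_bigmax _ (fun i : 'I_(m s).+1 => Num.bound (T (nat_of_ord i, m s)))
    (Ordinal km)).
have [x0 /= [mx0 kx0]] := TP _ _ Ts qx.
have [|b [bP mb]] := rP s s0 x0; first by rewrite ms.
have kb j : (j <= (m s).-1)%N -> q j (x0 - b) <= s%:R^-1.
  by move=> jms; rewrite (le_trans _ mb)// fundamental_mono.
exists b; split=> [j|]; last first.
  apply: le_trans (seminorm_dist _ _ x0 _) _.
  by rewrite -[2]/(1 + 1) mulrDl mul1r lerD// kb.
have [jms|] := leqP j (m s).-1.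
  rewrite -[b](subKr x0); apply: le_trans (seminormB (q_semi _) _ _) _.
  apply: (@le_trans _ _ (s%:R + s%:R)).
    apply: lerD; last first.
      by rewrite (le_trans (kb j jms))// (le_trans _ s1)// invf_le1 ?ltr0n.
    by apply: le_trans mx0; apply: fundamental_mono => //; rewrite -ms ltnW.
  by rewrite -mulr2n -[leLHS]mulr_natr ler_wpM2l.
rewrite -ltnS ms => msj.
have sS : (s < S j)%N.
  by rewrite ltnNge; apply/negP => /(SP j)[+ _]; rewrite leqNgt ltnS -ltnS msj.
apply: le_trans (bP j) _.
apply: (@le_trans _ _ (rho j)); last by rewrite ler_peMl// (le_trans _ (rho2 j)).
apply: le_trans (ler_norm _) _.
rewrite /rho (bigD1 (Ordinal sS))//= addrCA lerDl.
by rewrite addr_ge0// sumr_ge0.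
Qed.

End Radii.

(** * Comparison of Kolmogorov widths *)

Section Widths.
Context {R : realType} {c : scalar_kind} {X : tvsType (scalar_field R c)}.
Local Notation K := (scalar_field R c).

Lemma kolmogorov_width_ge0 n (V U : set X) : (0 <= kolmogorov_width n V U)%E.
Proof. by apply: le_ereal_inf_tmp => _ [d [d0 _] <-]; rewrite lee_fin ltW. Qed.

Lemma kolmogorov_width_le n (V U B W : set X) (C : R) : 0 < C ->
  (forall d (L : set X), 0 < d -> subspace_dim_le n L ->
    B `<=` [set u + l | u in dilate d W & l in L] ->
    V `<=` [set u + l | u in dilate (C * d) U & l in L]) ->
  (kolmogorov_width n V U <= C%:E * kolmogorov_width n B W)%E.
Proof.
move=> C0 CP; rewrite muleC -lee_pdivrMr//; apply: le_ereal_inf_tmp.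
move=> _ [d [d0 [L dimL BL]] <-]; rewrite lee_pdivrMr// -EFinM mulrC.
apply: ereal_inf_lbound; exists (C * d) => //; split; first exact: mulr_gt0.
by exists L => //; exact: CP.
Qed.

Lemma subspace0 n (L : set X) : subspace_dim_le n L -> L 0.
Proof.
move=> [v ->]; exists (fun=> 0); rewrite big1// => i _; exact: scale0r.
Qed.

Lemma subspaceD n (L : set X) x y : subspace_dim_le n L -> L x -> L y -> L (x + y).
Proof.
move=> [v ->] [a ->] [b ->]; exists (fun i => a i + b i).
by rewrite -big_split; apply: eq_bigr => i _; rewrite scalerDl.
Qed.

Lemma subspaceZ n (L : set X) (a : K) x : subspace_dim_le n L -> L x -> L (a *: x).
Proof.
move=> [v ->] [b ->]; exists (fun i => a * b i).
by rewrite scaler_sumr; apply: eq_bigr => i _; rewrite scalerA.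
Qed.

Lemma seminorm_ball_absolutely_convex (p : X -> R) (e : R) :
  seminorm p -> absolutely_convex [set x | p x < e].
Proof.
move=> p_semi; split=> [|a x /= a1 px].
  apply/convex_setW => x y; rewrite !inE /= => px py l l0 l1.
  have l1' := modulus_onem (ltW l0) (ltW l1).
  have ml0 : 0 < modulus l%:num.
    by rewrite -(ltr_of_real c) rmorph0 of_real_modulus gtr0_norm.
  have ml1 : modulus l%:num <= 1 by rewrite modulus_le1 ger0_norm// ltW.
  rewrite inE /=; change (p (l%:num *: (x : X) + (1 - l%:num) *: (y : X)) < e).
  apply: le_lt_trans (proj1 p_semi _ _) _.
  by rewrite !(proj2 p_semi) l1'; nra.
rewrite (proj2 p_semi) (le_lt_trans _ px)// ler_piMl ?seminorm_ge0//.
by rewrite modulus_le1.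
Qed.

(** Absolute values allow [xi] of any sign, and the squeeze takes place in the extended reals
    because widths may be infinite. *)
Lemma width_cvg0_le (xi : nat -> R) (f g : nat -> \bar R) (C : R) : 0 < C ->
  (forall n, 0 <= f n)%E -> (forall n, 0 <= g n)%E ->
  (forall n, f n <= C%:E * g n)%E ->
  ((xi n)%:E * g n)%E @[n --> \oo] --> 0%E -> ((xi n)%:E * f n)%E @[n --> \oo] --> 0%E.
Proof.
move=> C0 f0 g0 fg.
move=> /(cvg_abse0P _).2 xig; apply/cvg_abse0P.
have bnd : (C%:E * `|(xi n)%:E * g n|)%E @[n --> \oo] --> 0%E.
  by rewrite -[0%E](mule0 C%:E); apply: cvgeZl.
apply: (squeeze_cvge _ (cvg_cst 0%E) bnd).
apply: nearW => n; rewrite abse_ge0 /= !abseM (gee0_abs (f0 n)) (gee0_abs (g0 n)).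
by rewrite muleCA lee_wpmul2l.
Qed.

End Widths.

(** * Widths of seminorm balls against those of the polydisc *)

Section Prominence.
Context {R : realType} {c : scalar_kind} {X : tvsType (scalar_field R c)}.

Lemma dilate_ball (p : X -> R) (e r : R) x : seminorm p -> 0 < r ->
  p x < r * e -> dilate r [set y | p y < e] x.
Proof.
move=> p_semi r0 px; exists (of_real c r^-1 *: x).
  by rewrite /= (seminormZ p_semi) gtr0_norm ?invr_gt0// ltr_pdivrMl.
by rewrite scalerA -rmorphM divff ?gt_eqF// rmorph1 scale1r.
Qed.

Lemma dilate_subset r (U V : set X) : U `<=` V -> dilate r U `<=` dilate r V.
Proof. by move=> UV _ [x Ux <-]; exists x => //; exact: UV. Qed.

Lemma dilateM (r s : R) (U : set X) x :
  dilate s U x -> dilate (r * s) U (of_real c r *: x).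
Proof. by move=> [y Uy <-]; exists y => //; rewrite rmorphM scalerA. Qed.

(** The hypothesis is reapplied to the remainder [w], rescaled to the unit ball; the errors [a],
    [a / 2], ... sum to at most [2 * a], and the subspace parts stay in [L]. *)
Lemma half_absorption n (L : set X) (p q : X -> R) (a : R) :
  subspace_dim_le n L -> seminorm p -> seminorm q ->
  (forall x, q x <= 1 -> exists w l, [/\ L l, q w <= 2^-1 & p (x - (w + l)) <= a]) ->
  forall j x, q x <= 1 ->
    exists w l, [/\ L l, q w <= 2 ^- j & p (x - (w + l)) <= 2 * a].
Proof.
move=> dimL p_semi q_semi half j x qx.
(* The induction needs the exact partial sum of the geometric series. *)
suff [w [l [Ll qw pw]]] : exists w l,
    [/\ L l, q w <= 2 ^- j & p (x - (w + l)) <= 2 * a - 2 * a * 2 ^- j].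
  have [w0 [l0 [_ _ pa]]] := half x qx.
  have a0 := le_trans (seminorm_ge0 p_semi _) pa.
  exists w, l; split=> //; apply: le_trans pw _.
  by rewrite lerBlDr lerDl mulr_ge0 ?mulr_ge0// invr_ge0 exprn_ge0.
elim: j => [|j [w [l [Ll qw pw]]]].
  exists x, 0; split; first exact: subspace0 dimL.
    by rewrite expr0 invr1.
  by rewrite addr0 subrr seminorm0// expr0 invr1 mulr1 subrr.
have j0 : 0 < 2 ^+ j :> R by rewrite exprn_gt0.
have [|w' [l' [Ll' qw' pw']]] := half (of_real c (2 ^+ j) *: w).
  by rewrite seminormZ// gtr0_norm// -ler_pdivlMl// mulr1.
have j'0 : 0 < 2 ^- j :> R by rewrite invr_gt0.
exists (of_real c (2 ^- j) *: w'), (l + of_real c (2 ^- j) *: l'); split.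
- by apply: (subspaceD dimL) => //; exact: (subspaceZ _ dimL).
- by rewrite seminormZ// gtr0_norm// exprSr invfM ler_pM2l.
have -> : x - (of_real c (2 ^- j) *: w' + (l + of_real c (2 ^- j) *: l')) =
    (x - (w + l)) + of_real c (2 ^- j) *: (of_real c (2 ^+ j) *: w - (w' + l')).
  rewrite scalerBr scalerA -rmorphM mulVf ?gt_eqF// rmorph1 scale1r scalerDr.
  by rewrite [w + l]addrC !opprD !addrA subrK [x - l - _]addrAC.
apply: le_trans (proj1 p_semi _ _) _; rewrite seminormZ// gtr0_norm//.
have : 2 ^- j * p (of_real c (2 ^+ j) *: w - (w' + l')) <= 2 ^- j * a.
  by rewrite ler_pM2l.
have -> : 2 ^- j.+1 = 2 ^- j / 2 :> R by rewrite exprSr invfM.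
lra.
Qed.

Variables (q : nat -> X -> R) (rho : nat -> R).
Hypotheses (q_fund : fundamental_seminorms q) (rho_gt0 : forall j, 0 < rho j).
Let q_semi := fundamental_seminorm q_fund.

Let B : set X := [set x | forall j, q j x <= rho j].

Lemma polydisc_bounded : tvs_bounded B.
Proof.
move=> U [/(fundamental_nbhs q_fund)[k [e e0 kU]] _].
have r0 : 0 < rho k / e + 1 by rewrite ltr_pwDr// ltW// divr_gt0.
exists (rho k / e + 1) => // x Bx.
apply: (dilate_subset (U := [set y | q k y < e])).
  by move=> y /= qy; apply: kU; rewrite /= subr0.
apply: dilate_ball => //; apply: le_lt_trans (Bx k) _.
by rewrite mulrDl divfK ?gt_eqF// mul1r ltrDl.
Qed.

Lemma seminorm_ball_nbhs k : abs_convex_nbhs0 [set x | q k x < 1].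
Proof.
split; last exact: seminorm_ball_absolutely_convex.
by apply/(fundamental_nbhs q_fund); exists k, 1 => // x /=; rewrite subr0.
Qed.

Lemma width_le_polydisc k S n (e : R) (U : set X) : 0 < e ->
  [set x | q k x < e] `<=` U -> (0 < S)%N ->
  (forall s, (S <= s)%N -> forall x, q k.+1 x <= 1 ->
    exists b, (forall j, q j b <= s%:R * rho j) /\ q k (x - b) <= 2 / s%:R) ->
  (kolmogorov_width n [set x | q k.+1 x < 1]%R U <=
   ((18 + 2 * S%:R) / e)%:E * kolmogorov_width n B [set x | q k.+1 x < 1]%R)%E.
Proof.
move=> e0 kU S0 decomp; have S1 : 1 <= S%:R :> R by rewrite ler1n.
(* The summand [2 * S] covers large [d]; for small [d] the iteration gives [17 * d], and 18 makes
   the inequality strict. Dividing by [e] passes from the unit ball of [q k] to [U]. *)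
have C0 : 0 < (18 + 2 * S%:R) / e by rewrite divr_gt0//; lra.
apply: kolmogorov_width_le => // d L d0 dimL BL x /= qx.
have CdE : (18 + 2 * S%:R) / e * d * e = (18 + 2 * S%:R) * d.
  by field; rewrite gt_eqF.
have Cd0 : 0 < (18 + 2 * S%:R) / e * d by rewrite mulr_gt0.
suff [y [l [Ll ky xE]]] : exists y l,
    [/\ L l, q k y < (18 + 2 * S%:R) * d & x = y + l].
  exists y; last by exists l.
  by apply: dilate_subset kU _ _; apply: dilate_ball => //; rewrite CdE.
have [dS|dS] := ltP (2 * d)^-1 S%:R.
  exists x, 0; split; [exact: subspace0 dimL| |by rewrite addr0].
  apply: le_lt_trans (fundamental_mono q_fund x (leqnSn k)) _.
  have : 1 < S%:R * (2 * d) by rewrite -ltr_pdivrMr ?mulr_gt0// mul1r.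
  nra.
(* The integer part gives [s * d <= 2^-1], and [(2 * d)^-1 < s + 1 <= 2 * s] gives
   [2 / s <= 8 * d]. *)
pose s := Num.truncn (2 * d)^-1.
have d20 : 0 <= (2 * d)^-1 by rewrite invr_ge0 mulr_ge0 ?ltW.
have /andP[s_le s_gt] := truncn_itv d20.
rewrite -/s in s_le s_gt.
have Ss : (S <= s)%N by rewrite truncn_ge_nat.
have s1 : 1 <= s%:R :> R by apply: le_trans S1 _; rewrite ler_nat.
have s0 : 0 < s%:R :> R by lra.
have sd : s%:R * d <= 2^-1.
  by rewrite -ler_pdivlMr// -invfM.
have s8 : 2 / s%:R <= 8 * d.
  have d2 : 0 < 2 * d by rewrite mulr_gt0.
  move: s_gt; rewrite -natr1 -[ltLHS]mul1r ltr_pdivrMr// => s_gt.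
  by rewrite ler_pdivrMr//; nra.
have half y : q k.+1 y <= 1 -> exists w l,
    [/\ L l, q k.+1 w <= 2^-1 & q k (y - (w + l)) <= 8 * d].
  move=> qy; have [b [bB yb]] := decomp s Ss y qy.
  (* [b] lies in [s] times the polydisc, hence in [s * d] times the ball plus [L], and [s * d] is at
     most one half. *)
  have /BL[_ [u /= qu <-] [l Ll bE]] : B (of_real c s%:R^-1 *: b).
    by move=> j; rewrite seminormZ// gtr0_norm ?invr_gt0// ler_pdivrMl.
  exists (of_real c (s%:R * d) *: u), (of_real c s%:R *: l); split.
  - exact: (subspaceZ _ dimL).
  - rewrite seminormZ// gtr0_norm ?mulr_gt0//.
    by apply: le_trans sd; rewrite ger_pMr ?mulr_gt0// ltW.
  - suff -> : of_real c (s%:R * d) *: u + of_real c s%:R *: l = b by exact: le_trans s8.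
    rewrite rmorphM -scalerA -scalerDr bE scalerA -rmorphM divff ?gt_eqF//.
    by rewrite rmorph1 scale1r.
(* Enough iterations to bring the remainder [w] below [d]. *)
pose j := Num.bound d^-1.
have jd : 2 ^- j <= d.
  rewrite invf_ple ?posrE ?exprn_gt0//.
  have /archi_boundP/ltW/le_trans -> // : 0 <= d^-1 by rewrite invr_ge0 ltW.
  by rewrite -natrX ler_nat ltnW// ltn_expl.
have [w [l [Ll qw kw]]] :=
  half_absorption dimL (q_semi k) (q_semi k.+1) half j (ltW qx).
exists (x - l), l; split=> //; last by rewrite subrK.
have -> : x - l = x - (w + l) + w by rewrite opprD addrA addrAC subrK.
apply: le_lt_trans (proj1 (q_semi k) _ _) _.
have := fundamental_mono q_fund w (leqnSn k); nra.
Qed.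

End Prominence.

Theorem theorem2p1 (R : realType) (c : scalar_kind) (X : tvsType (scalar_field R c))
    (p : nat -> X -> R) :
  frechet X -> fundamental_seminorms p -> Omega_bar p ->
  exists B : set X, prominent B.
Proof.
move=> [_ X_complete] p_fund p_Omega.
have [q [q_fund q_abs]] := Omega_bar_subsequence p_fund p_Omega.
have [rho [rho0 decomp]] := prominent_radii X_complete q_fund q_abs.
exists [set x | forall j, q j x <= rho j].
have B_bounded := polydisc_bounded q_fund rho0; split=> //.
apply/seteqP; split=> xi /= xiP U UN.
(* This inclusion holds for every bounded set: [B] lies in a multiple of [V], so its widths are at
   most that multiple of those of [V]. *)
- have [V VN xiV] := xiP U UN; have [r r0 BV] := B_bounded V VN.
  apply: (width_cvg0_le r0 _ _ _ xiV) => n; try exact: kolmogorov_width_ge0.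
  apply: kolmogorov_width_le => // d L d0 dimL VL x /BV[v /VL[u Uu [l Ll <-]] <-].
  exists (of_real c r *: u); first exact: dilateM.
  exists (of_real c r *: l); first exact: (subspaceZ _ dimL).
  by rewrite scalerDr.
(* For [U] containing a ball of [q k], the unit ball of [q k.+1] is the required [V]; the condition
   on [xi] is used with this same ball as the reference neighbourhood. *)
- have /(fundamental_nbhs q_fund)[k [e e0 kU]] := UN.1.
  have [S S0 {}decomp] := decomp k.
  have qN := seminorm_ball_nbhs q_fund k.+1.
  exists [set x | q k.+1 x < 1] => //.
  apply: (width_cvg0_le _ _ _ _ (xiP _ qN)) => [|n|n|n].
  + by apply: (@divr_gt0 _ (18 + 2 * S%:R) e) => //; rewrite ltr_pwDl.
  + exact: kolmogorov_width_ge0.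
  + exact: kolmogorov_width_ge0.
  + apply: width_le_polydisc => //.
    by move=> x /= qx; apply: kU; rewrite /= subr0.
Qed.
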